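(* Let $E$ be a Banach lattice and let $G \subset \mathrm{ZAut}^+(E)\cdot \mathrm{IAut}^+(E)$ be a group. Then $p(G)$ is a group of isometric lattice automorphisms of $E$, with the same invariant ideals as $G$; that is, an order ideal $I \subset E$ is invariant under every element of $G$ if and only if it is invariant under every element of $p(G)$.
   Context: Banach lattices are real. $\mathrm{Aut}^+(E)$ is the group of lattice automorphisms of $E$ (these are automatically bounded), and $\mathrm{IAut}^+(E)$ is the subgroup of isometric lattice automorphisms. The center $Z(E)$ is the set of regular operators $m$ on $E$ with $-\lambda I \le m \le \lambda I$ for some $\lambda \ge 0$, and $\mathrm{ZAut}^+(E) := \mathrm{Aut}^+(E)\cap Z(E)$ is the group of central lattice automorphisms. The set $\mathrm{ZAut}^+(E)\cdot \mathrm{IAut}^+(E) = \{m\phi : m \in \mathrm{ZAut}^+(E), \phi \in \mathrm{IAut}^+(E)\}$ is a subgroup of $\mathrm{Aut}^+(E)$, the factorization $m\phi$ of each of its elements is unique, and the map $p\colon \mathrm{ZAut}^+(E)\cdot \mathrm{IAut}^+(E) \to \mathrm{IAut}^+(E)$, $p(m\phi) := \phi$, is a group homomorphism. *)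

(* Defs.v *)
From HB Require Import structures.
From mathcomp Require Import all_boot all_order all_algebra.
From mathcomp Require Import all_classical all_reals.
From mathcomp Require Import topology normedtype.
Set Implicit Arguments.
Unset Strict Implicit.
Unset Printing Implicit Defensive.

Import Order.TTheory GRing.Theory Num.Theory.
Import numFieldNormedType.Exports.
Local Open Scope classical_set_scope.
Local Open Scope ring_scope.

(* The order is a field of the mixin, rather than an Order.POrder or
   Order.Lattice structure: Hierarchy Builder rejects a structure joining
   these with CompleteNormedModule, since numDomainType and realDomainType
   already inherit from both sides without a common join. *)
HB.mixin Record Lmodule_isRiesz (R : realType) E of GRing.Lmodule R E := {
  vle : rel E ;
  vle_refl : reflexive vle ;
  vle_anti : antisymmetric vle ;
  vle_trans : transitive vle ;
  vle_add2r : forall z x y : E, vle x y -> vle (x + z) (y + z) ;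
  vle_scale : forall (a : R) (x y : E),
    0 <= a -> vle x y -> vle (a *: x) (a *: y) ;
  vsup : E -> E -> E ;
  vinf : E -> E -> E ;
  vsup_le : forall x y z : E, vle (vsup x y) z = vle x z && vle y z ;
  le_vinf : forall x y z : E, vle z (vinf x y) = vle z x && vle z y
}.

#[short(type="rieszType")]
HB.structure Definition Riesz (R : realType) :=
  {E of GRing.Lmodule R E & Lmodule_isRiesz R E}.

Definition modulus (R : realType) (E : rieszType R) (x : E) : E :=
  vsup x (- x).

HB.mixin Record NormedRiesz_isBanachLattice (R : realType) E
    of CompleteNormedModule R E & Riesz R E := {
  ler_norm_modulus : forall x y : E,
    vle (modulus x) (modulus y) -> `|x| <= `|y|
}.

#[short(type="banachLatticeType")]
HB.structure Definition BanachLattice (R : realType) :=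
  {E of CompleteNormedModule R E & Riesz R E
      & NormedRiesz_isBanachLattice R E}.

Definition order_ideal (R : realType) (E : rieszType R) (I : set E) : Prop :=
  [/\ I 0,
      forall x y, I x -> I y -> I (x + y),
      forall (a : R) x, I x -> I (a *: x)
    & forall x y, vle (modulus x) (modulus y) -> I y -> I x].

Definition invariant_under (T : Type) (I : set T) (f : T -> T) : Prop :=
  f @` I `<=` I.

Definition is_bijection_group (T : Type) (G : set (T -> T)) : Prop :=
  [/\ G idfun,
      forall f g, G f -> G g -> G (f \o g)
    & forall f, G f -> exists g, [/\ G g, cancel f g & cancel g f]].

Definition positive_op (R : realType) (E : rieszType R) (f : E -> E) : Prop :=
  forall x, vle 0 x -> vle 0 (f x).

Definition le_op (R : realType) (E : rieszType R) (f g : E -> E) : Prop :=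
  positive_op (g \- f).

Definition regular_op (R : realType) (E : rieszType R) (m : E -> E) : Prop :=
  exists f g : E -> E,
    [/\ linear f, linear g, positive_op f, positive_op g & m = f \- g].

Definition op_center (R : realType) (E : rieszType R) : set (E -> E) :=
  [set m | regular_op m /\
     exists2 lambda : R, 0 <= lambda &
       le_op (fun x => - lambda *: x) m /\ le_op m (fun x => lambda *: x)].
Arguments op_center {R} E.

Definition lattice_hom (R : realType) (E : rieszType R) (f : E -> E) : Prop :=
  [/\ linear f, {morph f : x y / vsup x y} & {morph f : x y / vinf x y}].

Definition Aut_plus (R : realType) (E : rieszType R) : set (E -> E) :=
  [set f | lattice_hom f /\ bijective f].
Arguments Aut_plus {R} E.

Definition IAut_plus (R : realType) (E : banachLatticeType R) : set (E -> E) :=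
  [set f | Aut_plus E f /\ forall x, `|f x| = `|x|].
Arguments IAut_plus {R} E.

Definition ZAut_plus (R : realType) (E : rieszType R) : set (E -> E) :=
  Aut_plus E `&` op_center E.
Arguments ZAut_plus {R} E.

Definition ZIAut_plus (R : realType) (E : banachLatticeType R) : set (E -> E) :=
  [set f | exists m phi, [/\ ZAut_plus E m, IAut_plus E phi & f = m \o phi]].
Arguments ZIAut_plus {R} E.

(* The map p : m \o phi |-> phi; its value outside ZIAut_plus E is junk (idfun). *)
Definition isometric_part (R : realType) (E : banachLatticeType R)
    (f : E -> E) : E -> E :=
  xget (idfun : E -> E)
    [set phi : E -> E | IAut_plus E phi /\ exists2 m, ZAut_plus E m & f = m \o phi].

(* Main.v *)
(* The heart of the matter is that the factorization [m phi] is unique. If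
   [m phi = n psi], then [f = psi phi^-1] is an isometric lattice automorphism
   with [m = n f], so it preserves disjointness from any element. Such an [f]
   satisfies [f^2 - 2 f + 1 >= 0], as if it were a multiplication operator. For
   [c > 1] and [x >= 0], this inequality for [c f] shows that
   [y = (x - c f x)^+] satisfies [c f y <= y]; as [f] is isometric, [y = 0].
   Letting [c] tend to 1 gives [x <= f x], and by symmetry [f = 1].
   Hence [p] is multiplicative. Order ideals are invariant under central
   operators, so those invariant under [p(G)] are invariant under [G];
   conversely, if [g] is the inverse of [f] in [G] and [g = n p(g)], then [p(f) = f n]. *)
Require Import Defs.
From mathcomp Require Import all_boot all_order all_algebra.
From mathcomp Require Import all_classical all_reals.
From mathcomp Require Import topology normedtype.
From mathcomp Require Import ring lra.
Import Order.TTheory GRing.Theory Num.Theory.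
Set Implicit Arguments.
Unset Strict Implicit.
Unset Printing Implicit Defensive.
Local Open Scope classical_set_scope.
Local Open Scope ring_scope.

(** * Order arithmetic and positive parts in a Riesz space *)

Section RieszOrder.
Context {R : realType} {E : rieszType R}.
Implicit Types (x y z : E) (a : R).

Lemma vle_le_trans x y z : vle x y -> vle y z -> vle x z.
Proof. exact: vle_trans. Qed.

Lemma subv_ge0 x y : vle 0 (y - x) = vle x y.
Proof.
apply/idP/idP => [/(vle_add2r x)|/(vle_add2r (- x))].
  by rewrite add0r subrK.
by rewrite subrr.
Qed.

Lemma vle_add x y z t : vle x y -> vle z t -> vle (x + z) (y + t).
Proof.
move=> xy zt; apply: (@vle_le_trans _ (y + z)); first exact: vle_add2r.
by rewrite ![y + _]addrC; apply: vle_add2r.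
Qed.

Lemma addv_ge0 x y : vle 0 x -> vle 0 y -> vle 0 (x + y).
Proof. by move=> x0 y0; rewrite -[0]addr0; apply: vle_add. Qed.

Lemma scalev_ge0 a x : 0 <= a -> vle 0 x -> vle 0 (a *: x).
Proof. by move=> a0 x0; rewrite -(scaler0 E a); apply: vle_scale. Qed.

Lemma vle_eq x y : vle x y -> vle y x -> x = y.
Proof. by move=> xy yx; apply: vle_anti; rewrite xy yx. Qed.

Lemma vle_supl x y : vle x (vsup x y).
Proof. by have := vle_refl (vsup x y); rewrite vsup_le => /andP[]. Qed.

Lemma vle_supr x y : vle y (vsup x y).
Proof. by have := vle_refl (vsup x y); rewrite vsup_le => /andP[]. Qed.

Lemma vinf_lel x y : vle (vinf x y) x.
Proof. by have := vle_refl (vinf x y); rewrite le_vinf => /andP[]. Qed.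

Lemma vinf_ler x y : vle (vinf x y) y.
Proof. by have := vle_refl (vinf x y); rewrite le_vinf => /andP[]. Qed.

Lemma vsup_mono x y x' y' :
  vle x x' -> vle y y' -> vle (vsup x y) (vsup x' y').
Proof.
move=> xx yy; rewrite vsup_le (vle_le_trans xx (vle_supl _ _)).
by rewrite (vle_le_trans yy (vle_supr _ _)).
Qed.

Lemma vsup_scale a x y : 0 < a -> vsup (a *: x) (a *: y) = a *: vsup x y.
Proof.
move=> a0; have aK z : a *: (a^-1 *: z) = z.
  by rewrite scalerA divff ?scale1r ?gt_eqF.
have ai z t : vle (a *: z) t -> vle z (a^-1 *: t).
  move=> zt; rewrite -[z](scalerK (lt0r_neq0 a0)).
  by apply: vle_scale zt; rewrite invr_ge0 ltW.
apply: vle_eq.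
  by rewrite vsup_le !vle_scale ?vle_supl ?vle_supr ?ltW.
rewrite -[vsup (a *: x) _]aK; apply: vle_scale; first exact: ltW.
by rewrite vsup_le !ai ?vle_supl ?vle_supr.
Qed.

Lemma vinfC x y : vinf x y = vinf y x.
Proof. by apply: vle_eq; rewrite le_vinf vinf_lel vinf_ler. Qed.

Lemma vpart_ge0 x : vle 0 (vsup x 0).
Proof. exact: vle_supr. Qed.

Lemma vparts_addl x : x + vsup (- x) 0 = vsup x 0.
Proof.
apply: vle_eq.
  rewrite addrC -subv_ge0 opprD addrCA addrC subv_ge0 vsup_le.
  rewrite -subv_ge0 opprK subrK vpart_ge0 /=.
  by rewrite subv_ge0 vle_supl.
rewrite vsup_le -{1}[x]addr0 vle_add ?vle_refl ?vpart_ge0 //=.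
by rewrite -[0](subrr x) vle_add ?vle_refl ?vle_supl.
Qed.

Lemma vpartsB x : vsup x 0 - vsup (- x) 0 = x.
Proof. by rewrite -vparts_addl addrK. Qed.

(** If [w] is the infimum, then [x^- - w] still dominates both [- x] and [0], because
    [x + x^- = x^+]. Hence it dominates [x^-], which forces [w <= 0]. *)
Lemma vinf_parts x : vinf (vsup x 0) (vsup (- x) 0) = 0.
Proof.
apply: vle_eq; last by rewrite le_vinf !vpart_ge0.
set q := vsup (- x) 0; set w := vinf _ _.
suff : vle q (q - w) by rewrite -subv_ge0 addrAC subrr add0r -sub0r subv_ge0.
rewrite {1}/q vsup_le subv_ge0 vinf_ler andbT.
rewrite -subv_ge0 opprK addrC addrA subv_ge0 vparts_addl.
exact: vinf_lel.
Qed.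

Lemma vle0_vpart x : vsup x 0 = 0 -> vle x 0.
Proof. by move=> <-; exact: vle_supl. Qed.

Lemma modulus_ge0 x : vle 0 (modulus x).
Proof.
rewrite /modulus -[vsup _ _](scalerK (_ : 2%:R != 0 :> R)) ?pnatr_eq0 //.
apply: scalev_ge0; first by rewrite invr_ge0 ler0n.
(* Twice the modulus dominates [x + (- x) = 0]. *)
by rewrite scaler_nat -(subrr x) mulr2n vle_add ?vle_supl ?vle_supr.
Qed.

Lemma modulus_id x : vle 0 x -> modulus x = x.
Proof.
move=> x0; apply: vle_eq; last exact: vle_supl.
rewrite vsup_le vle_refl /= -subv_ge0 opprK; exact: addv_ge0.
Qed.

Lemma modulusZ a x : 0 < a -> modulus (a *: x) = a *: modulus x.
Proof. by move=> a0; rewrite /modulus -scalerN vsup_scale. Qed.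

End RieszOrder.

(** * Disjoint positive elements *)

Section Disjointness.
Context {R : realType} {E : rieszType R}.
Implicit Types (x y z : E) (a : R).

Definition disjv x y : Prop := [/\ vle 0 x, vle 0 y & vinf x y = 0].

Lemma disjvC x y : disjv x y -> disjv y x.
Proof. by case=> x0 y0 xy; split=> //; rewrite vinfC. Qed.

Lemma disjv_lel x y z : vle 0 z -> vle z x -> disjv x y -> disjv z y.
Proof.
move=> z0 zx [x0 y0 xy]; split=> //; apply: vle_eq.
  rewrite -xy le_vinf vinf_ler andbT.
  exact: vle_le_trans (vinf_lel _ _) zx.
by rewrite le_vinf z0 y0.
Qed.

Lemma disjv_le0 x y : disjv x y -> vle x y -> x = 0.
Proof.
move=> [x0 _ xy] lexy; apply: vle_eq => //.
by rewrite -xy le_vinf vle_refl.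
Qed.

(** Let [w] be the infimum of [x + y] and [z]. Then [w - x] lies below [y] and below [z], hence
    below [0]; so [w] is a lower bound of [x] and [z]. *)
Lemma disjvD x y z : disjv x z -> disjv y z -> disjv (x + y) z.
Proof.
move=> [x0 z0 xz] [y0 _ yz]; split=> //; first exact: addv_ge0.
apply: vle_eq; last by rewrite le_vinf addv_ge0.
set w := vinf _ _.
have wz : vle w z by exact: vinf_ler.
suff : vle (w - x) (vinf y z).
  rewrite yz => h; rewrite -xz le_vinf wz andbT.
  by rewrite -subv_ge0 -(opprB w x) -sub0r subv_ge0.
rewrite le_vinf; apply/andP; split.
  by rewrite -subv_ge0 opprB addrCA addrA subv_ge0 vinf_lel.
apply: (@vle_le_trans _ _ _ w) => //.
by rewrite -subv_ge0 opprB addrCA subrr addr0.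
Qed.

(** Additivity gives natural multiples, and [a *: x] lies below one of these. *)
Lemma disjvZ a x y : 0 <= a -> disjv x y -> disjv (a *: x) y.
Proof.
move=> a0 dxy; have [x0 y0 _] := dxy.
have dn n : disjv (n%:R *: x) y.
  elim: n => [|n IHn].
    rewrite scale0r; apply: disjv_lel dxy => //; exact: vle_refl.
  by rewrite -natr1 scalerDl scale1r; apply: disjvD.
apply: (@disjv_lel ((Num.bound a)%:R *: x)) => //; first exact: scalev_ge0.
rewrite -subv_ge0 -scalerBl; apply: scalev_ge0 => //.
by rewrite subr_ge0 ltW // archi_boundP.
Qed.

Lemma disjv_parts x : disjv (vsup x 0) (vsup (- x) 0).
Proof. by split; rewrite ?vpart_ge0 ?vinf_parts. Qed.

End Disjointness.

(** * Positive operators that preserve disjointness from each element *)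

Section Local.
Context {R : realType} {E : rieszType R}.
Implicit Types (f g h : E -> E) (x y z : E) (a : R).

Lemma linearDx f (lf : linear f) x y : f (x + y) = f x + f y.
Proof. by have := lf 1 x y; rewrite !scale1r. Qed.

Lemma linear0x f (lf : linear f) : f 0 = 0.
Proof. by apply: (@addrI _ (f 0)); rewrite -(linearDx lf) !addr0. Qed.

Lemma linearZx f (lf : linear f) a x : f (a *: x) = a *: f x.
Proof. by rewrite -[a *: x]addr0 lf (linear0x lf) addr0. Qed.

Lemma linearBx f (lf : linear f) x y : f (x - y) = f x - f y.
Proof.
by rewrite (linearDx lf) -scaleN1r (linearZx lf) scaleN1r.
Qed.

(** These are the positive orthomorphisms, abstract analogues of multiplication by a nonnegative
    function. *)
Definition positive_local f : Prop :=
  [/\ linear f, positive_op f & forall x y, disjv x y -> disjv (f x) y].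

Lemma positive_local_comp f g :
  positive_local f -> positive_local g -> positive_local (f \o g).
Proof.
move=> [lf pf df] [lg pg dg]; split=> [a x y|x x0|x y dxy] /=.
- by rewrite lg lf.
- by apply/pf/pg.
- exact/df/dg.
Qed.

(** Put [P = f^2 + a f + 1], and let [p], [q] be the positive and negative parts of [z]. The
    hypothesis reads [P q <= P p], and [q <= P q] by positivity. But [P p] is disjoint from [q], so
    [q = 0]. *)
Lemma local_quadratic_reflects_ge0 f a z : positive_local f -> 0 <= a ->
  vle 0 (f (f z) + a *: f z + z) -> vle 0 z.
Proof.
move=> [lf pf df] a0; set p := vsup z 0; set q := vsup (- z) 0.
pose P (x : E) := f (f x) + a *: f x + x.
have Pz : P z = P p - P q.
  rewrite -{1}[z]vpartsB -/p -/q /P !(linearBx lf) scalerBr.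
  by rewrite !opprD (AC (2*2*2) (1*3*5*(2*4*6))).
rewrite -/(P z) Pz subv_ge0 => lePqp.
have q0 : vle 0 q by exact: vpart_ge0.
have dP : disjv (P p) q.
  have dpq := disjv_parts z; have dfp := df _ _ dpq.
  by apply: disjvD => //; apply: disjvD; [exact: df | exact: disjvZ].
have q_eq0 : q = 0.
  apply: (disjv_le0 (disjvC dP)); apply: vle_le_trans lePqp.
  rewrite /P -{1}[q]add0r; apply: vle_add (vle_refl q).
  by apply: addv_ge0; [exact/pf/pf | exact/scalev_ge0/pf].
by rewrite -[z]vpartsB -/q q_eq0 subr0 vpart_ge0.
Qed.

(* [(t^2 - 2 r t + 1) (t^2 + 2 r t + 1) = t^4 - 2 (2 r^2 - 1) t^2 + 1], and
   passing from [r >= 0] to [2 r^2 - 1] at least doubles [1 - r], so finitely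
   many such steps make all the coefficients nonnegative. *)
Lemma local_quadratic_ge0 (n : nat) f (r : R) x : positive_local f ->
  1 <= 2 ^+ n * (1 - r) -> vle 0 x ->
  vle 0 (f (f x) - (2 * r) *: f x + x).
Proof.
elim: n f r => [|n IHn] f r locf ler x0; have [lf pf _] := locf;
  have [r0|r0] := leP r 0.
- apply: addv_ge0 => //; apply: addv_ge0; first exact/pf/pf.
  rewrite -scaleNr; apply: scalev_ge0; last exact: pf.
  by rewrite oppr_ge0; lra.
- by move: ler; rewrite expr0; lra.
- apply: addv_ge0 => //; apply: addv_ge0; first exact/pf/pf.
  rewrite -scaleNr; apply: scalev_ge0; last exact: pf.
  by rewrite oppr_ge0; lra.
apply: (@local_quadratic_reflects_ge0 f (2 * r)) => //; first lra.
have -> : forall z, z = f (f x) - (2 * r) *: f x + x ->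
  f (f z) + (2 * r) *: f z + z =
  (f \o f) ((f \o f) x) - (2 * (2 * r ^+ 2 - 1)) *: (f \o f) x + x.
- move=> z ->; rewrite /= !(linearDx lf) -!scaleNr !(linearZx lf).
  set u1 := f x; set u2 := f u1; set u3 := f u2; set u4 := f u3.
  rewrite !scalerDr !scalerA (AC (3*3*3) (1*(2*4)*(3*5*7)*(6*8)*9)) /=.
  rewrite -!scalerDl addNr subrr !scale0r !addr0.
  congr (_ + _ + _).
  rewrite -[X in X + _ *: _ + X]scale1r -!scalerDl.
  by congr (_ *: _); ring.
- apply: IHn => //; first exact: positive_local_comp.
  have [r1|r1] := leP r 1.
    apply: (le_trans ler); rewrite exprSr -mulrA ler_pM2l ?exprn_gt0 //.
    nra.
  have : 2 ^+ n.+1 * (1 - r) < 0.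
    by rewrite pmulr_rlt0 ?exprn_gt0 // subr_lt0.
  lra.
- by [].
Qed.


Lemma exp2_archi (e : R) : 0 < e -> exists n, 1 <= 2 ^+ n * e.
Proof.
move=> e0; exists (Num.bound e^-1).
rewrite -ler_pdivrMr // mul1r ltW // (lt_trans (archi_boundP _)) //.
  by rewrite invr_ge0 ltW.
by rewrite -natrX ltr_nat ltn_expl.
Qed.

Lemma positive_local_scale a f :
  0 <= a -> positive_local f -> positive_local (fun x => a *: f x).
Proof.
move=> a0 [lf pf df]; split=> [b x y|x x0|x y dxy].
- by rewrite lf scalerDr !scalerA mulrC.
- exact/scalev_ge0/pf.
- exact/disjvZ/df.
Qed.

Lemma lattice_hom_positive f : lattice_hom f -> positive_op f.
Proof.
move=> [lf fsup _] x x0; have xE : vsup x 0 = x.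
  by apply: vle_eq; rewrite ?vle_supl // vsup_le vle_refl.
by rewrite -xE fsup (linear0x lf) vpart_ge0.
Qed.

Lemma linear_positive_mono f x y :
  linear f -> positive_op f -> vle x y -> vle (f x) (f y).
Proof.
by move=> lf pf xy; rewrite -subv_ge0 -(linearBx lf) pf // subv_ge0.
Qed.

End Local.

(** * Central lattice automorphisms *)

Section LatticeAutomorphisms.
Context {R : realType} {E : rieszType R}.
Implicit Types (f g m n : E -> E) (x y z : E).

Lemma lattice_hom_modulus f x : lattice_hom f -> f (modulus x) = modulus (f x).
Proof.
by move=> [lf fsup _]; rewrite /modulus fsup -sub0r (linearBx lf)
  (linear0x lf) sub0r.
Qed.

Lemma Aut_plus_comp f g : Aut_plus E f -> Aut_plus E g -> Aut_plus E (f \o g).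
Proof.
move=> [[lf fs fi] bf] [[lg gs gi] bg]; split; last exact: bij_comp.
split=> [a x y|x y|x y] /=; first by rewrite lg lf.
  by rewrite gs fs.
by rewrite gi fi.
Qed.

Lemma Aut_plus_inv f g :
  cancel f g -> cancel g f -> Aut_plus E f -> Aut_plus E g.
Proof.
move=> fK gK [[lf fs fi] _]; split; last by exists f.
split=> [a x y|x y|x y]; apply: (can_inj fK).
- by rewrite lf !gK.
- by rewrite fs !gK.
- by rewrite fi !gK.
Qed.

Lemma ZAut_plus_bound m : ZAut_plus E m ->
  exists2 l : R, 0 < l & forall x, vle 0 x -> vle (m x) (l *: x).
Proof.
(* Adding 1 makes the bound strictly positive, as [modulusZ] requires. *)
move=> [_ [_ [l l0 [_ ml]]]]; exists (l + 1); first by rewrite ltr_wpDl.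
move=> x x0; apply: (@vle_le_trans _ _ _ (l *: x)).
  by have := ml x x0; rewrite /= subv_ge0.
by rewrite -subv_ge0 -scalerBl scalev_ge0 // addrAC subrr add0r.
Qed.

(** Lattice automorphisms are positive, so regularity and the lower bound come for free: [m = m - 0]
    and [- l x <= 0 <= m x] for [x >= 0]. *)
Lemma bounded_ZAut_plus m (l : R) : Aut_plus E m -> 0 <= l ->
  (forall x, vle 0 x -> vle (m x) (l *: x)) -> ZAut_plus E m.
Proof.
move=> autm l0 ml; split=> //; have [hm _] := autm; have [lm _ _] := hm.
have pm := lattice_hom_positive hm; split.
  exists m, (fun=> 0); split=> //.
  - by move=> a x y; rewrite scaler0 addr0.
  - by move=> x _; exact: vle_refl.
  - by apply/funext => x /=; rewrite subr0.
exists l => //; split=> x x0 /=; last by rewrite subv_ge0 ml.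
by rewrite scaleNr opprK addv_ge0 ?pm ?scalev_ge0.
Qed.

Lemma ZAut_plus_comp m n : ZAut_plus E m -> ZAut_plus E n ->
  ZAut_plus E (m \o n).
Proof.
move=> Zm Zn; have [l l0 ml] := ZAut_plus_bound Zm.
have [k k0 nk] := ZAut_plus_bound Zn; have [[hn _] _] := Zn.
apply: (@bounded_ZAut_plus _ (l * k)).
  by apply: Aut_plus_comp; [case: Zm | case: Zn].
  by rewrite mulr_ge0 ?ltW.
move=> x x0 /=; apply: vle_le_trans (ml _ (lattice_hom_positive hn x0)) _.
by rewrite -scalerA; apply: vle_scale (nk _ x0); exact: ltW.
Qed.

(** The same bound survives conjugation: [f (m (g x)) <= f (l *: g x) = l *: x]. This normality lets
    central factors move past isometric ones. *)
Lemma ZAut_plus_conj f g m : cancel f g -> cancel g f -> Aut_plus E f ->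
  ZAut_plus E m -> ZAut_plus E (f \o m \o g).
Proof.
move=> fK gK autf Zm; have autg := Aut_plus_inv fK gK autf.
have [l l0 ml] := ZAut_plus_bound Zm; have [[lf _ _] _] := autf.
apply: (@bounded_ZAut_plus _ l); [|exact: ltW|].
  by apply: Aut_plus_comp => //; apply: Aut_plus_comp => //; case: Zm.
move=> x x0 /=; rewrite -[x in l *: x]gK -(linearZx lf).
apply: linear_positive_mono => //; first exact: lattice_hom_positive autf.1.
exact/ml/(lattice_hom_positive autg.1).
Qed.

Lemma idfun_ZAut_plus : ZAut_plus E idfun.
Proof.
apply: (@bounded_ZAut_plus _ 1) => //.
by move=> x _; rewrite scale1r vle_refl.
Qed.

Lemma ZAut_plus_disjv m x y : ZAut_plus E m -> disjv x y -> disjv (m x) y.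
Proof.
move=> Zm dxy; have [l l0 ml] := ZAut_plus_bound Zm.
have [x0 _ _] := dxy; apply: disjv_lel (ml _ x0) (disjvZ (ltW l0) dxy).
exact: lattice_hom_positive Zm.1.1 _ x0.
Qed.

(* [inf x y = 0] gives [inf (m x) (n y) = 0], that is [n (inf (f x) y) = 0]. *)
Lemma central_quotient_local m n f : ZAut_plus E m -> ZAut_plus E n ->
  Aut_plus E f -> m = n \o f -> positive_local f.
Proof.
move=> Zm Zn [hf _] mE; have [lf _ _] := hf.
have pf := lattice_hom_positive hf; split=> // x y dxy.
have [x0 y0 _] := dxy; have [[[ln _ ni] bn] _] := Zn.
split=> //; first exact: pf.
apply: (bij_inj bn); rewrite ni (linear0x ln).
have [_ _ <-] := disjvC (ZAut_plus_disjv Zn (disjvC (ZAut_plus_disjv Zm dxy))).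
by rewrite mE.
Qed.

(** Solidity applies since [|m x| = m |x| <= l |x| = |l x|] for the moduli. *)
Lemma ZAut_plus_ideal m (I : set E) x :
  ZAut_plus E m -> order_ideal I -> I x -> I (m x).
Proof.
move=> Zm [_ _ IZ Isolid] Ix; have [l l0 ml] := ZAut_plus_bound Zm.
apply: (Isolid _ (l *: x)); last exact: IZ.
rewrite -(lattice_hom_modulus _ Zm.1.1) modulusZ //; exact/ml/modulus_ge0.
Qed.

End LatticeAutomorphisms.

(** * Limits in the order and rigidity of local isometries *)

Section BanachLattice.
Context {R : realType} {E : banachLatticeType R}.
Implicit Types (f g m n phi psi : E -> E) (x y z : E).

Lemma ler_normv x y : vle 0 x -> vle x y -> `|x| <= `|y|.
Proof.
move=> x0 xy; apply: ler_norm_modulus.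
by rewrite !modulus_id // (vle_le_trans x0).
Qed.

(** The positive part of [x] also lies below every [e *: y], so monotonicity of the norm makes its
    norm arbitrarily small. *)
Lemma vle_archimedean x y : vle 0 y ->
  (forall e : R, 0 < e -> vle x (e *: y)) -> vle x 0.
Proof.
move=> y0 xy; apply/vle0_vpart/eqP; rewrite -normr_le0.
apply/ler_addgt0Pl => e e0; rewrite addr0.
(* The added 1 keeps the divisor nonzero when [y = 0]. *)
have k0 : 0 < `|y| + 1 by rewrite ltr_wpDl.
apply: (@le_trans _ _ `|(e / (`|y| + 1)) *: y|).
  apply: ler_normv (vpart_ge0 x) _; rewrite vsup_le xy ?divr_gt0 //=.
  by rewrite scalev_ge0 // divr_ge0 ?ltW.
rewrite normrZ gtr0_norm ?divr_gt0 // mulrAC ler_pdivrMr //.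
by rewrite ler_wpM2l ?ltW // ltrDl.
Qed.

(** [local_quadratic_ge0] needs [r < 1], so it is used at [r = 1 - e / 2]; the error [e *: f x] then
    vanishes by the Archimedean property. *)
Lemma local_square_ge0 f x : positive_local f -> vle 0 x ->
  vle 0 (f (f x) - 2 *: f x + x).
Proof.
move=> locf x0; have [_ pf _] := locf.
suff : vle (2 *: f x - (f (f x) + x)) 0.
  by rewrite -subv_ge0 sub0r opprB addrAC.
apply: (vle_archimedean (pf _ x0)) => e e0.
have [n en] : exists n : nat, 1 <= 2 ^+ n * (e / 2) by apply: exp2_archi; lra.
have := @local_quadratic_ge0 _ _ n f (1 - e / 2) x locf _ x0.
rewrite opprB addrCA subrr addr0 => /(_ en).
have -> : 2 * (1 - e / 2) = 2 - e by field.
rewrite scalerBl opprB (AC (1*2*1) (2*((1*4)*3))) /=.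
by rewrite -[vle _ (e *: _)]subv_ge0 opprB.
Qed.

Lemma local_isometry_ge f x : positive_local f -> lattice_hom f ->
  (forall z, `|f z| = `|z|) -> vle 0 x -> vle x (f x).
Proof.
move=> locf [lf fsup _] isof x0; have [_ pf _] := locf.
suff : vle (x - f x) 0 by rewrite -subv_ge0 sub0r opprB subv_ge0.
apply: (vle_archimedean (pf _ x0)) => e e0; set c := 1 + e.
have c0 : 0 < c by rewrite /c; lra.
set w := x - c *: f x; set y := vsup w 0.
(* Rearranged, the square inequality for [c f] at [x] says [c f w <= w]; the lattice homomorphism
   [f] lets one take positive parts. *)
have fyy : vle (c *: f y) y.
  rewrite fsup (linear0x lf) -vsup_scale // scaler0.
  apply: vsup_mono (vle_refl _).
  have := local_square_ge0 (positive_local_scale (ltW c0) locf) x0.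
  rewrite -(subv_ge0 (c *: f w)) /w (linearBx lf) scalerBr.
  by rewrite scaler_nat mulr2n !opprD opprK (AC (1*2*1) (4*3*(2*1))).
have : vle w 0.
  apply/vle0_vpart/eqP; rewrite -/y -normr_le0.
  (* Taking norms gives [(1 + e) |y| <= |y|], so [y] has norm 0. *)
  have := ler_normv (scalev_ge0 (ltW c0) (pf _ (vpart_ge0 w))) fyy.
  rewrite normrZ isof gtr0_norm // /c mulrDl mul1r gerDl.
  by rewrite pmulr_rle0.
by rewrite /w /c scalerDl scale1r opprD addrA -subv_ge0 sub0r opprB subv_ge0.
Qed.

(** * Uniqueness of the factorization *)

Lemma IAut_plus_comp phi psi :
  IAut_plus E phi -> IAut_plus E psi -> IAut_plus E (phi \o psi).
Proof.
move=> [aphi iphi] [apsi ipsi]; split; first exact: Aut_plus_comp.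
by move=> x /=; rewrite iphi.
Qed.

Lemma IAut_plus_inv phi psi : cancel phi psi -> cancel psi phi ->
  IAut_plus E phi -> IAut_plus E psi.
Proof.
move=> phiK psiK [aphi iphi]; split; first exact: Aut_plus_inv aphi.
by move=> x; rewrite -iphi psiK.
Qed.

Lemma central_quotient_isometry_ge m n phi x : ZAut_plus E m ->
  ZAut_plus E n -> IAut_plus E phi -> m = n \o phi ->
  vle 0 x -> vle x (phi x).
Proof.
move=> Zm Zn [aphi iphi] mE; apply: local_isometry_ge => //.
  exact: central_quotient_local mE.
by case: aphi.
Qed.

Lemma ZIAut_plus_factor_inj m n phi psi : ZAut_plus E m -> ZAut_plus E n ->
  IAut_plus E phi -> IAut_plus E psi -> m \o phi = n \o psi -> phi = psi.
Proof.
move=> Zm Zn Iphi Ipsi mn.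
have [[_ [phi' phiK phi'K]] _] := Iphi.
have [[_ [psi' psiK psi'K]] _] := Ipsi.
have Ieta := IAut_plus_comp Ipsi (IAut_plus_inv phiK phi'K Iphi).
have Ieta' := IAut_plus_comp Iphi (IAut_plus_inv psiK psi'K Ipsi).
have mnx x : m (phi x) = n (psi x) by have /(congr1 (@^~ x)) := mn.
have mE : m = n \o (psi \o phi').
  by apply/funext => x; rewrite /= -mnx phi'K.
have nE : n = m \o (phi \o psi').
  by apply/funext => x; rewrite /= mnx psi'K.
(* With [eta = psi phi^-1], both [eta] and its inverse are central quotients. So [x <= eta x], and
   the inverse at [eta x] gives [eta x <= x]. *)
have peta x : vle 0 x -> psi (phi' x) = x.
  move=> x0; apply: vle_eq; last first.
    exact: (central_quotient_isometry_ge Zm Zn Ieta mE).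
  have := central_quotient_isometry_ge Zn Zm Ieta' nE
    (lattice_hom_positive Ieta.1.1 x0).
  by rewrite /= psiK phi'K.
(* Splitting [phi x] into its parts extends [eta = 1] from positive elements. *)
apply/funext => x; have [[leta _ _] _] := Ieta.1.
have := linearBx leta (vsup (phi x) 0) (vsup (- phi x) 0).
by rewrite vpartsB /= phiK !peta ?vpart_ge0 // vpartsB.
Qed.

(** * The projection onto the isometric factor *)

Lemma isometric_partP f : ZIAut_plus E f ->
  IAut_plus E (isometric_part f) /\
  exists2 m, ZAut_plus E m & f = m \o isometric_part f.
Proof.
move=> [m [phi [Zm Iphi fE]]].
by apply: (@xgetPex _ _ [set phi : E -> E | IAut_plus E phi /\
  exists2 m, ZAut_plus E m & f = m \o phi]); exists phi; split=> //; exists m.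
Qed.

Lemma isometric_part_comp m phi : ZAut_plus E m -> IAut_plus E phi ->
  isometric_part (m \o phi) = phi.
Proof.
move=> Zm Iphi; have [|Ip [n Zn /esym nE]] := @isometric_partP (m \o phi).
  by exists m, phi.
exact: ZIAut_plus_factor_inj nE.
Qed.

Lemma isometric_partM f g : ZIAut_plus E f -> ZIAut_plus E g ->
  isometric_part (f \o g) = isometric_part f \o isometric_part g.
Proof.
move=> /isometric_partP[Iphi [m Zm fE]] /isometric_partP[Ipsi [n Zn gE]].
rewrite [in LHS]fE [in LHS]gE.
set phi := isometric_part f in Iphi fE *.
set psi := isometric_part g in Ipsi gE *.
have [[_ [phi' phiK phi'K]] _] := Iphi.
(* Conjugating [n] by [phi] collects the central factors on the left. *)
have -> : (m \o phi) \o (n \o psi) =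
    (m \o (phi \o n \o phi')) \o (phi \o psi).
  by apply/funext => x /=; rewrite phiK.
apply: isometric_part_comp; last exact: IAut_plus_comp.
by apply: ZAut_plus_comp => //; apply: ZAut_plus_conj => //; case: Iphi.
Qed.

Lemma isometric_part_idfun : isometric_part (idfun : E -> E) = idfun.
Proof.
rewrite -[idfun in LHS]/(idfun \o idfun); apply: isometric_part_comp.
  exact: idfun_ZAut_plus.
by split=> //; case: (@idfun_ZAut_plus _ E).
Qed.

Lemma isometric_part_cancel f g : ZIAut_plus E f -> ZIAut_plus E g ->
  cancel f g -> cancel (isometric_part f) (isometric_part g).
Proof.
move=> Zf Zg fK x; have : g \o f = idfun by apply/funext.
move=> /(congr1 (@isometric_part R E)).
by rewrite isometric_partM // isometric_part_idfun => /(congr1 (@^~ x)).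
Qed.

End BanachLattice.

(** * The projected group and its invariant ideals *)

Theorem theorem3p2 (R : realType) (E : banachLatticeType R) (G : set (E -> E))
    (subG : G `<=` ZIAut_plus E) (grpG : is_bijection_group G) :
  [/\ [set isometric_part f | f in G] `<=` IAut_plus E,
      is_bijection_group [set isometric_part f | f in G]
    & forall I : set E, order_ideal I ->
        (forall g, G g -> invariant_under I g) <->
        (forall phi, [set isometric_part f | f in G] phi ->
           invariant_under I phi)].
Proof.
have [G1 GM GV] := grpG; split.
- by move=> _ [f /subG Zf <-]; case: (isometric_partP Zf).
- split; first by exists idfun => //; exact: isometric_part_idfun.
  + move=> _ _ [f Gf <-] [g Gg <-]; exists (f \o g); first exact: GM.
    by apply: isometric_partM; exact: subG.
  + move=> _ [f Gf <-]; have [g [Gg fK gK]] := GV f Gf.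
    exists (isometric_part g); split; first by exists g.
    * by apply: isometric_part_cancel => //; exact: subG.
    * by apply: isometric_part_cancel => //; exact: subG.
move=> I idI; split=> [Ginv _ [f Gf <-] _ [x Ix <-]|pGinv f Gf _ [x Ix <-]].
  have [g [Gg fK gK]] := GV f Gf.
  have pfK := isometric_part_cancel (subG f Gf) (subG g Gg) fK.
  have [_ [n Zn gE]] := isometric_partP (subG g Gg).
  (* Expand [f (g y) = y] at [y = isometric_part f x]: the isometric part of [g] returns [y] to [x],
     leaving [f (n x)]. *)
  have -> : isometric_part f x = f (n x).
    by rewrite -[LHS]gK [in X in f X]gE /= pfK.
  apply: (Ginv f Gf); exists (n x) => //; exact: ZAut_plus_ideal Zn idI Ix.
have [_ [m Zm fE]] := isometric_partP (subG f Gf).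
rewrite fE; apply: ZAut_plus_ideal Zm idI _.
by apply: (pGinv (isometric_part f)); [exists f | exists x].
Qed.
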